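(* Cramér's conjecture is equivalent to the map $1/n \mapsto 1/p_n$ being Lipschitz. That is, the following two statements are equivalent: (i) there exists a constant $C > 0$ such that $p_{n+1} - p_n \leq C (\log p_n)^2$ for all integers $n \geq 1$; (ii) the map $f : \{1/n : n \geq 1\} \to \{1/p_n : n \geq 1\}$, $f(1/n) = 1/p_n$, is Lipschitz, i.e. there exists a constant $c \geq 1$ such that \[ \left|\frac{1}{p_n} - \frac{1}{p_m}\right| \leq c \left|\frac{1}{n} - \frac{1}{m}\right| \] for all integers $m, n \geq 1$.
   Context: $p_n$ denotes the $n$th prime number, indexed by positive integers $n \geq 1$ in increasing order ($p_1 = 2$, $p_2 = 3$, ...). $\log$ is the natural logarithm. Cramér's conjecture is the assertion (i). *)

(* Defs.v *)
From mathcomp Require Import all_boot all_order all_algebra.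
From mathcomp Require Import all_classical all_reals all_analysis.
Import Order.TTheory GRing.Theory Num.Theory.
Import numFieldNormedType.Exports.

Set Implicit Arguments.
Unset Strict Implicit.
Unset Printing Implicit Defensive.

Lemma exists_prime_above (m : nat) : exists p, (m < p) && prime p.
Proof. by have [p mp pp] := prime_above m; exists p; rewrite mp pp. Qed.

Definition next_prime (m : nat) : nat := ex_minn (exists_prime_above m).

(* [nth_prime n] is the n-th prime counted from 1; the starting value
   [nth_prime 0 = 0] is not a prime. *)
Definition nth_prime (n : nat) : nat := iter n next_prime 0.

Lemma next_primeP (m : nat) :
  [/\ m < next_prime m, prime (next_prime m) &
      forall q, m < q -> prime q -> next_prime m <= q].
Proof.
rewrite /next_prime; case: ex_minnP => p /andP[mp pp] pmin.
by split=> // q mq pq; apply: pmin; rewrite mq pq.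
Qed.

Lemma nth_prime_prime (n : nat) : 0 < n -> prime (nth_prime n).
Proof. by case: n => // n _; have [] := next_primeP (nth_prime n). Qed.

Lemma nth_prime_ltS (n : nat) : nth_prime n < nth_prime n.+1.
Proof. by have [] := next_primeP (nth_prime n). Qed.

Lemma nth_prime_surj (q : nat) : prime q -> exists2 n, 0 < n & nth_prime n = q.
Proof.
move=> pq.
have ge_id n : n <= nth_prime n.
  by elim: n => // n IH; apply: leq_ltn_trans IH (nth_prime_ltS n).
have ex : exists n, q <= nth_prime n by exists q.
case: (ex_minnP ex) => -[|n] qn nmin.
  by move: pq qn; case: q {ex nmin}.
exists n.+1 => //; apply/eqP; rewrite eqn_leq qn andbT.
have [_ _] := next_primeP (nth_prime n); apply=> //.
by rewrite ltnNge; apply/negP => /nmin; rewrite ltnn.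
Qed.

Local Open Scope classical_set_scope.
Local Open Scope ring_scope.

Definition cramer_conjecture (R : realType) : Prop :=
  exists2 C : R, 0 < C &
    forall n : nat, (0 < n)%N ->
      (nth_prime n.+1)%:R - (nth_prime n)%:R <= C * ln (nth_prime n)%:R ^+ 2.

Definition unit_fractions (R : realType) : set R :=
  [set n%:R^-1 | n in [set n : nat | (0 < n)%N]].
Arguments unit_fractions R : clear implicits.

(* Only the values of [f] on [unit_fractions R] are constrained: [f] stands for
   the map {1/n : n >= 1} -> {1/p_n : n >= 1}. *)
Definition sends_to_prime_reciprocals (R : realType) (f : R -> R) : Prop :=
  forall n : nat, (0 < n)%N -> f n%:R^-1 = (nth_prime n)%:R^-1.

Lemma sends_to_prime_reciprocals_ex (R : realType) :
  exists f : R -> R, sends_to_prime_reciprocals f.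
Proof.
exists (fun x => (nth_prime (Num.truncn x^-1))%:R^-1) => n _.
by rewrite invrK natrK.
Qed.

Lemma lipschitz_unit_fractionsE (R : realType) (f : R -> R) (c : R) :
  sends_to_prime_reciprocals f ->
  c.-lipschitz_(unit_fractions R) f <->
  forall m n : nat, (0 < m)%N -> (0 < n)%N ->
    `|(nth_prime n)%:R^-1 - (nth_prime m)%:R^-1| <=
      c * `|n%:R^-1 - m%:R^-1|.
Proof.
move=> hf; split=> [lip m n m0 n0|lip [_ _] /= [[n n0 <-] [m m0 <-]]].
  rewrite -!hf //; apply: (lip (n%:R^-1, m%:R^-1)).
  by split; [exists n|exists m].
by rewrite !hf //; apply: lip.
Qed.

(* Main.v *)
Require Import Defs.
From mathcomp Require Import all_boot all_order all_algebra.
From mathcomp Require Import all_classical all_reals all_analysis.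
From mathcomp Require Import zify ring lra.
Import Order.TTheory GRing.Theory Num.Theory.
Import numFieldNormedType.Exports.
Local Open Scope classical_set_scope.
Local Open Scope ring_scope.

(** For consecutive indices the Lipschitz inequality reads
    p_{n+1} - p_n <= c p_n p_{n+1} / (n (n + 1)), and by telescoping these
    instances imply all the others. It therefore suffices that p_n is of order
    n log p_n and that log p_{n+1} = O(log p_n). The bound n log p_n = O(p_n)
    follows from n! <= p_1 ... p_n <= 8^{p_n}, the converse from Chebyshev's
    estimate 2^m <= 'C(2m, m) <= (2m)^{pi(2m)} with m = p_n / 2; the latter
    also makes p_{n+1} polynomially bounded in p_n. *)

Local Open Scope nat_scope.

(** * Products over the first primes *)

Lemma nth_prime_gt n : 0 < n -> n < nth_prime n.
Proof.
elim: n => // -[_ _|n IH _]; first by have [_ /prime_gt1] := next_primeP 0.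
by apply: leq_ltn_trans (nth_prime_ltS n.+1); apply: IH.
Qed.

(** Only the right end of the range from p_k + 1 to p_{k+1} is prime. With [F] the identity this
    treats the primorial; with [F] constant it counts the k primes up to p_k. *)
Lemma prod_prime_nth_prime (F : nat -> nat) k :
  \prod_(0 <= q < (nth_prime k).+1 | prime q) F q =
  \prod_(1 <= i < k.+1) F (nth_prime i).
Proof.
elim: k => [|k IH]; first by rewrite big_mkcond big_nat1 big_geq.
have [lt_k pr_k min_k] := next_primeP (nth_prime k).
rewrite (@big_cat_nat _ _ _ (nth_prime k).+1) //=; last exact: ltnW.
rewrite IH [RHS]big_nat_recr //=; congr muln.
rewrite big_mkcond big_nat_recr //= pr_k big1_seq ?mul1n // => q /=.
rewrite mem_index_iota => /andP[lt_q q_lt]; case: ifP => // pr_q.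
by have := min_k q lt_q pr_q; rewrite leqNgt q_lt.
Qed.

(** * Binomial coefficients and the primorial *)

Lemma bin_leq_exp2 n m : 'C(n, m) <= 2 ^ n.
Proof.
elim: n m => [[|m]|n IH [|m]] //; first by rewrite bin0 expn_gt0.
by rewrite binS expnS mul2n -addnn leq_add.
Qed.

(** Pascal's rule splits 'C(2n + 2, n + 1) into two terms, each at least 'C(2n, n). *)
Lemma exp2_leq_central_bin n : 2 ^ n <= 'C(n.*2, n).
Proof.
elim: n => // n IH.
rewrite doubleS binS expnS mul2n -addnn; apply: leq_add.
  by apply: leq_trans IH _; rewrite binS leq_addl.
by apply: leq_trans IH _; apply: leq_bin2l.
Qed.

Lemma dvdn_prod_primes a b N :
  (forall q, a <= q < b -> prime q -> q %| N) ->
  \prod_(a <= q < b | prime q) q %| N.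
Proof.
elim: b => [|b IH] dvN; first by rewrite big_geq.
have [ltba|leab] := ltnP b a; first by rewrite big_geq.
have dvN' : \prod_(a <= q < b | prime q) q %| N.
  by apply: IH => q /andP[aq qb]; apply: dvN; rewrite aq ltnS ltnW.
rewrite big_mkcond big_nat_recr //= -big_mkcond /=.
case: ifP => [pr_b|_]; last by rewrite muln1.
rewrite Gauss_dvd; first by rewrite dvN' dvN ?leab ?ltnSn.
rewrite coprime_sym prime_coprime // Euclid_dvd_prod // big_has_cond -all_predC.
apply/allP => q; rewrite mem_index_iota => /andP[_ qb] /=.
apply/negP => /andP[pr_q]; rewrite dvdn_prime2 // => /eqP bq.
by rewrite bq ltnn in qb.
Qed.

(** Erdős's argument, by strong induction. An even n > 2 adds no prime. For n = 2m + 1, the primes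
    above m + 1 divide the numerator of 'C(n, m) but not its denominator, so their product divides
    'C(n, m), which is at most 2^n. *)
Lemma primorial_leq n : \prod_(0 <= q < n.+1 | prime q) q <= 8 ^ n.
Proof.
elim/ltn_ind: n => n IH.
have [n_le2|n_gt2] := leqP n 2.
  case: n n_le2 {IH} => [|[|[|//]]] _;
  by rewrite big_mkcond /index_iota /= ?big_cons ?big_nil.
have [odd_n|even_n] := boolP (odd n); last first.
  rewrite big_mkcond big_nat_recr //= -big_mkcond /=.
  case: ifP => [pr_n|_].
    by have /(prime_oddPn pr_n) n2 := even_n; rewrite n2 in n_gt2.
  rewrite muln1; case: n n_gt2 IH {even_n} => // n _ IH.
  by apply: leq_trans (IH n (ltnSn _)) _; rewrite leq_exp2l.
have [m n_def] : exists m, n = m.*2.+1.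
  by exists n./2; rewrite -[LHS]odd_double_half odd_n.
have m_gt0 : 0 < m by lia.
have lt_mn : m.+1 < n by lia.
rewrite (@big_cat_nat _ _ _ m.+2) //=; last by lia.
have dvC : \prod_(m.+2 <= q < n.+1 | prime q) q %| 'C(n, m).
  apply: dvdn_prod_primes => q /andP[mq qn] pr_q.
  have le_mn : m <= n by lia.
  have := bin_fact le_mn => /(congr1 (dvdn q)).
  rewrite dvdn_fact ?prime_gt0 //= !Euclid_dvdM //.
  have ndv j : j < q -> (q %| j`!) = false.
    elim: j => [|j IHj] jq; first by rewrite fact0 dvdn1; case: (q) pr_q => [|[]].
    rewrite factS Euclid_dvdM // IHj ?(ltnW jq) // orbF.
    by apply/negbTE/negP => /(dvdn_leq (ltn0Sn _)); rewrite leqNgt jq.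
  by rewrite !ndv ?orbF //; lia.
have := dvdn_leq _ dvC; rewrite bin_gt0 => /(_ ltac:(lia)) leC.
have le1 := IH m.+1 lt_mn.
apply: leq_trans (leq_mul le1 (leq_trans leC (bin_leq_exp2 _ _))) _.
(* The exponents of 2 satisfy 3(m + 1) + (2m + 1) <= 3(2m + 1), because m >= 1. *)
rewrite -[8]/(2 ^ 3) -!expnM -expnD leq_exp2l //; lia.
Qed.

(** Factor by factor, i < p_i, so k! is at most the primorial of p_k. *)
Lemma fact_leq_exp_nth_prime k : k`! <= 8 ^ nth_prime k.
Proof.
apply: leq_trans (primorial_leq _).
rewrite (prod_prime_nth_prime id) fact_prod big_nat_cond [leqRHS]big_nat_cond.
by apply: leq_prod => i /andP[/andP[i0 _] _]; apply/ltnW/nth_prime_gt.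
Qed.

(** * Prime powers in the central binomial coefficient *)

Lemma sum_leq_indicator t n : \sum_(1 <= k < n.+1) (k <= t) <= t.
Proof.
suff : \sum_(1 <= k < n.+1) (k <= t) <= minn n t by lia.
elim: n => [|n IH]; first by rewrite big_geq.
by rewrite big_nat_recr //=; case: leqP => /= ; lia.
Qed.

(* Kummer's bound, by Legendre's formula: each term
   [2n %/ q ^ k - 2 (n %/ q ^ k)] is at most 1 and vanishes once [q ^ k > 2n]. *)
Lemma logn_central_bin n q : 0 < n -> prime q ->
  q ^ logn q 'C(n.*2, n) <= n.*2.
Proof.
move=> n_gt0 pr_q; have q_gt1 := prime_gt1 pr_q.
have n2_gt0 : 0 < n.*2 by rewrite double_gt0.
apply: leq_trans (trunc_logP q_gt1 n2_gt0); rewrite leq_exp2l //.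
have le_n2 : n <= n.*2 by lia.
have := bin_fact le_n2; have -> : n.*2 - n = n by lia.
move=> /(congr1 (logn q)).
rewrite !lognM ?muln_gt0 ?fact_gt0 ?bin_gt0 // !logn_fact //.
(* Since q^k > k, the terms with k > n vanish, and both Legendre sums can share the range up to
   2n. *)
have -> : \sum_(1 <= k < n.+1) n %/ q ^ k = \sum_(1 <= k < n.*2.+1) n %/ q ^ k.
  rewrite [RHS](@big_cat_nat _ _ _ n.+1) //= [X in _ + X]big1_seq ?addn0 // => k.
  rewrite mem_index_iota => /andP[_ /andP[nk _]].
  by rewrite divn_small // (leq_trans nk) // ltnW // ltn_expl.
set t := trunc_log q n.*2; set S := \sum_(1 <= k < _) n %/ _.
suff : \sum_(1 <= k < n.*2.+1) n.*2 %/ q ^ k <= S + S + t by lia.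
apply: leq_trans (leq_add (leqnn _) (sum_leq_indicator t n.*2)).
rewrite -!big_split /=; apply: leq_sum => k _.
have [kt|tk] := leqP k t; first by rewrite -addnn; apply: leq_divDl.
rewrite divn_small // (leq_trans (trunc_log_ltn _ q_gt1)) // leq_exp2l //.
Qed.

(** In the prime factorization of 'C(2n, n) each prime power is at most 2n, so no prime above 2n
    occurs. The right-hand side is (2n)^{pi(2n)}. *)
Lemma central_bin_leq n : 0 < n ->
  'C(n.*2, n) <= \prod_(0 <= q < n.*2.+1 | prime q) n.*2.
Proof.
move=> n_gt0; have C_gt0 : 0 < 'C(n.*2, n) by rewrite bin_gt0; lia.
(* Running the product up to the maximum of 'C(2n, n) and 2n allows a split at 2n without comparing
   the two. *)
rewrite -[leqLHS]partnT // (widen_partn _ (leq_maxl _ n.*2)).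
rewrite (@big_cat_nat _ _ _ n.*2.+1) //= ?ltnS ?leq_maxr //.
rewrite [X in _ * X]big1_seq ?muln1 => [|q /=]; last first.
  rewrite mem_index_iota => /andP[nq _]; rewrite lognE.
  case: ifP => // /and3P[pr_q _ dvq].
  have le_n2 : n <= n.*2 by lia.
  have := prime_gt0 pr_q.
  have : q <= n.*2; last by rewrite leqNgt nq.
  have := logn_central_bin n q n_gt0 pr_q; apply: leq_trans.
  by rewrite -[leqLHS]expn1 leq_exp2l ?prime_gt1 // logn_gt0 mem_primes pr_q C_gt0.
rewrite [leqRHS]big_mkcond; apply: leq_prod => q _.
case: ifPn => [pr_q|npr_q]; first exact: logn_central_bin.
by rewrite lognE (negbTE npr_q).
Qed.

(** With n the half of p_k rounded down, 'C(2n, n) is bounded by one factor 2n <= p_k for each prime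
    up to 2n, hence by k such factors. *)
Lemma exp2_leq_nth_prime k : 0 < k -> 2 ^ (nth_prime k)./2 <= nth_prime k ^ k.
Proof.
move=> k_gt0; set p := nth_prime k; set n := p./2.
have p_gt1 : 1 < p by apply: leq_ltn_trans (nth_prime_gt k k_gt0).
have n_gt0 : 0 < n by rewrite half_gt0.
have np : n.*2 <= p by rewrite -[leqRHS]odd_double_half leq_addl.
apply: leq_trans (exp2_leq_central_bin n) _.
apply: leq_trans (central_bin_leq n n_gt0) _.
have -> : p ^ k = \prod_(0 <= q < p.+1 | prime q) p.
  by rewrite (prod_prime_nth_prime (fun=> p)) prod_nat_const_nat subn1.
rewrite [leqRHS](@big_cat_nat _ _ _ n.*2.+1) //=.
rewrite -[leqLHS]muln1 leq_mul //; first by apply: leq_prod.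
by rewrite prodn_cond_gt0 // => _ _; apply: ltnW.
Qed.

(** * Logarithms and the order of growth of the primes *)

Local Open Scope ring_scope.

Lemma ln_leB1 (R : realType) (x : R) : 0 < x -> ln x <= x - 1.
Proof. by move=> x0; rewrite -{1}(subrKC 1 x); apply: le_ln1Dx; lra. Qed.

(** Apply ln y <= y - 1 to y = sqrt x and use ln x = 2 ln y. *)
Lemma ln_le_sqrt (R : realType) (x : R) : 0 < x -> ln x <= 2 * Num.sqrt x.
Proof.
move=> x0; have s0 : 0 < Num.sqrt x by rewrite sqrtr_gt0.
rewrite -[in leLHS](sqr_sqrtr (ltW x0)) lnXn // -[leLHS]mulr_natl ler_pM2l //.
by apply: le_trans (ln_leB1 _ _ s0) _; rewrite gerBl.
Qed.

Lemma ln2_ge_half (R : realType) : 2^-1 <= ln 2 :> R.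
Proof.
have : ln (2^-1) <= 2^-1 - 1 :> R by apply: ln_leB1; rewrite invr_gt0.
by rewrite lnV ?posrE //; lra.
Qed.

Lemma ln_nat_homo (R : realType) (m n : nat) : (0 < m <= n)%N ->
  ln (m%:R : R) <= ln n%:R.
Proof.
move=> /andP[m0 mn]; rewrite ler_ln ?posrE ?ltr0n ?ler_nat //.
exact: leq_trans mn.
Qed.

Lemma ln_nth_prime_ge_half (R : realType) k : (0 < k)%N ->
  2^-1 <= ln (nth_prime k)%:R :> R.
Proof.
move=> k0; apply: le_trans (ln2_ge_half R) _; apply: ln_nat_homo.
by rewrite prime_gt1 // nth_prime_prime.
Qed.

Lemma nth_prime_le_mul_ln (R : realType) k : (0 < k)%N ->
  (nth_prime k)%:R <= 6 * k%:R * ln (nth_prime k)%:R :> R.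
Proof.
move=> k0; have := exp2_leq_nth_prime k k0; set p := nth_prime k.
have p1 : (1 < p)%N by rewrite prime_gt1 // nth_prime_prime.
move=> le2p; have : ln ((2 ^ p./2)%:R : R) <= ln (p ^ k)%:R.
  by apply: ln_nat_homo; rewrite expn_gt0.
rewrite !natrX !lnXn ?ltr0n ?(ltnW p1) // -[leLHS]mulr_natl -[leRHS]mulr_natl => le_ln.
(* The constant 6 is 3 * 2: rounding in [p./2] costs at most a factor 3 since p >= 2, and ln 2 >=
   1/2. *)
have : p%:R <= 3 * (p./2)%:R :> R by rewrite -natrM ler_nat; lia.
have := ler_wpM2l (ler0n R p./2) (ln2_ge_half R); lra.
Qed.

(** If k^2 <= p, then k <= sqrt p and ln p <= 2 sqrt p suffice. Otherwise ln p <= 2 ln k, and k ln k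
    <= 4p comes from the factorial bound and k^k <= k! e^k. *)
Lemma mul_ln_le_nth_prime (R : realType) k : (0 < k)%N ->
  k%:R * ln (nth_prime k)%:R <= 8 * (nth_prime k)%:R :> R.
Proof.
move=> k0; have := fact_leq_exp_nth_prime k; have := nth_prime_gt k k0.
set p := nth_prime k => kp factp.
have p0 : 0 < p%:R :> R by rewrite ltr0n; apply: leq_ltn_trans kp.
have k0R : 0 < k%:R :> R by rewrite ltr0n.
have kpR : k%:R <= p%:R :> R by rewrite ler_nat ltnW.
have [kkp|pkk] := leqP (k ^ 2) p.
  have : k%:R <= Num.sqrt p%:R :> R.
    by rewrite -(ger0_norm (ltW k0R)) -sqrtr_sqr -natrX ler_sqrt ?ler_nat ?ltW.
  have := ln_le_sqrt R _ p0; have := sqr_sqrtr (ltW p0).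
  have := sqrtr_ge0 (p%:R : R); set s := Num.sqrt _; set l := ln _.
  by move=> s0 sp ls ks; nra.
have lnp : ln (p%:R : R) <= 2 * ln k%:R.
  rewrite mulr_natl -lnXn // -natrX; apply: ln_nat_homo.
  by rewrite -(ltr0n R) p0 ltnW.
suff : k%:R * ln k%:R <= 4 * p%:R :> R by move=> ?; nra.
have fact0 : 0 < k`!%:R :> R by rewrite ltr0n fact_gt0.
have e0 := expR_gt0 (k%:R : R).
(* k^k / k! is a single term of the series of e^k. *)
have : k%:R ^+ k <= k`!%:R * expR k%:R :> R.
  rewrite mulrC -ler_pdivrMr //.
  case: k k0 k0R {kp factp kpR pkk lnp fact0 e0 p p0} => // k _ k0R.
  by apply: le_trans (expR_ge1Dxn k (ltW k0R)); rewrite lerDr.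
rewrite -ler_ln ?posrE ?mulr_gt0 ?exprn_gt0 // lnM ?posrE // expRK lnXn //.
rewrite -[leLHS]mulr_natl.
have : ln (k`!%:R : R) <= ln (8 ^ p)%:R.
  by apply: ln_nat_homo; rewrite fact_gt0.
rewrite natrX lnXn // -[8%:R]/((2 ^ 3)%:R) natrX lnXn // -mulrnA -[leRHS]mulr_natl natrM.
(* Now k ln k <= 3p ln 2 + k <= 4p. *)
have : ln 2 <= 1 :> R by apply: le_trans (ln_leB1 R 2 _) _ => //; lra.
by nra.
Qed.

(** For p = p_k and q = p_{k+1}, the bounds q <= 6(k + 1) ln q and ln q <= 2 sqrt q give sqrt q <=
    12(k + 1). As k + 1 <= p and 12 <= 2^4 <= p^4, this yields q <= p^10. *)
Lemma ln_nth_primeS_le (R : realType) k : (0 < k)%N ->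
  ln (nth_prime k.+1)%:R <= 10 * ln (nth_prime k)%:R :> R.
Proof.
move=> k0; have kp := nth_prime_gt k k0.
have := nth_prime_le_mul_ln R k.+1 isT.
set p := nth_prime k in kp *; set q := nth_prime k.+1 => le_q.
have p1 : (1 < p)%N by rewrite prime_gt1 // nth_prime_prime.
have q0 : 0 < q%:R :> R by rewrite ltr0n prime_gt0 // nth_prime_prime.
have := ln_le_sqrt R _ q0; have := sqr_sqrtr (ltW q0).
have s0 : 0 < Num.sqrt q%:R :> R by rewrite sqrtr_gt0.
set s := Num.sqrt _ in s0 *; move=> sq lns.
have s_le : s <= 12 * k.+1%:R.
  rewrite -(ler_pM2r s0) -expr2 sq; apply: le_trans le_q _.
  rewrite -mulrA [leRHS](_ : _ = 6 * (k.+1%:R * (2 * s))); last by ring.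
  by rewrite !ler_wpM2l.
have s_le2 : s <= (p ^ 5)%:R.
  apply: le_trans s_le _; rewrite -natrM ler_nat expnSr mulnC.
  rewrite (leq_trans (leq_mul kp (_ : 12 <= 2 ^ 4)%N)) //.
  by rewrite mulnC leq_mul // leq_exp2r.
rewrite mulr_natl -lnXn ?ltr0n ?(ltnW p1) // -natrX; apply: ln_nat_homo.
rewrite -(ltr0n R) q0 -(ler_nat R) -sq (expnM p 5 2) natrX.
by apply: lerXn2r; rewrite ?nnegrE ?ler0n // ltW.
Qed.

(** * Reduction to consecutive indices *)

Lemma telescope_le (R : realDomainType) (u v : nat -> R) :
  (forall i, (0 < i)%N -> u i - u i.+1 <= v i - v i.+1) ->
  forall m n, (0 < m)%N -> (m <= n)%N -> u m - u n <= v m - v n.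
Proof.
move=> step m n m0; elim: n => [|n IH].
  by rewrite leqn0 => /eqP m_eq; rewrite m_eq in m0.
rewrite leq_eqVlt => /predU1P[<-|]; first by rewrite !subrr.
rewrite ltnS => mn; have := IH mn; have := step n (leq_trans m0 mn); lra.
Qed.

Lemma invrB_consecutive (R : numFieldType) (n : nat) : (0 < n)%N ->
  n%:R^-1 - n.+1%:R^-1 = (n%:R * n.+1%:R)^-1 :> R.
Proof.
move=> n0; have n0R : n%:R != 0 :> R by rewrite pnatr_eq0 -lt0n.
have n1R : n.+1%:R != 0 :> R by rewrite pnatr_eq0.
by rewrite -[X in _ - X]mul1r -[X in X - _]mul1r -mulNr addf_div // -natr1 mul1r
  mulN1r addrAC subrr add0r mul1r.
Qed.

(** Both 1/n and 1/p_n decrease, so ordering the indices removes the absolute values and the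
    inequality becomes additive along consecutive steps. Clearing denominators turns each step into
    a bound on a prime gap. *)
Lemma lipschitz_nth_prime_consecutive (R : realType) (c : R) :
  0 <= c ->
  (forall m n : nat, (0 < m)%N -> (0 < n)%N ->
    `|(nth_prime n)%:R^-1 - (nth_prime m)%:R^-1| <= c * `|n%:R^-1 - m%:R^-1|)
  <-> forall k, (0 < k)%N ->
    k%:R * k.+1%:R * ((nth_prime k.+1)%:R - (nth_prime k)%:R) <=
      c * ((nth_prime k)%:R * (nth_prime k.+1)%:R) :> R.
Proof.
move=> c0; have p0 k : (0 < k)%N -> 0 < (nth_prime k)%:R :> R.
  by move=> k0; rewrite ltr0n prime_gt0 // nth_prime_prime.
have gapE k : (0 < k)%N ->
    ((nth_prime k)%:R^-1 - (nth_prime k.+1)%:R^-1 <=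
       c * (k%:R^-1 - k.+1%:R^-1) :> R) =
    (k%:R * k.+1%:R * ((nth_prime k.+1)%:R - (nth_prime k)%:R) <=
      c * ((nth_prime k)%:R * (nth_prime k.+1)%:R) :> R).
  move=> k0; have pk := p0 k k0; have pk1 := p0 k.+1 isT.
  have kk : 0 < k%:R * k.+1%:R :> R by rewrite mulr_gt0 ?ltr0n.
  rewrite invrB_consecutive // ler_pdivlMr // mulrC.
  rewrite -[leRHS](mulfK (lt0r_neq0 (mulr_gt0 pk pk1))) ler_pdivlMr ?mulr_gt0 //.
  congr (_ <= _); by field; rewrite !lt0r_neq0.
have nth_prime_homo := homo_leq (leqnn) leq_trans (fun k => ltnW (nth_prime_ltS k)).
have pgt0 k : (0 < k)%N -> (0 < nth_prime k)%N.
  by move=> k0; rewrite prime_gt0 // nth_prime_prime.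
have invB_ge0 (a b : nat) : (0 < a)%N -> (a <= b)%N ->
    0 <= a%:R^-1 - b%:R^-1 :> R.
  move=> a0 ab; rewrite subr_ge0 lef_pV2 ?posrE ?ltr0n ?ler_nat //.
  exact: leq_trans ab.
split=> [lip k k0|gap m n m0 n0].
  rewrite -gapE //; have := lip k.+1 k isT k0.
  rewrite (ger0_norm (invB_ge0 _ _ (pgt0 k k0) (ltnW (nth_prime_ltS k)))).
  by rewrite (ger0_norm (invB_ge0 _ _ k0 (leqnSn k))).
wlog nm : m n m0 n0 / (n <= m)%N.
  move=> H; have [|/ltnW] := leqP n m; first exact: H.
  by rewrite distrC [in leRHS]distrC; apply: H.
rewrite (ger0_norm (invB_ge0 _ _ (pgt0 n n0) (nth_prime_homo _ _ nm))).
rewrite (ger0_norm (invB_ge0 _ _ n0 nm)).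
rewrite mulrBr; pose u k : R := (nth_prime k)%:R^-1.
apply: (telescope_le R u (fun k => c * k%:R^-1)) => // k k0.
by rewrite -mulrBr gapE // gap.
Qed.

Theorem mainTheorem5 (R : realType) (f : R -> R)
    (hf : sends_to_prime_reciprocals f) :
  cramer_conjecture R <->
  exists2 c : R, 1 <= c & c.-lipschitz_(unit_fractions R) f.
Proof.
split=> [[C C0 cramer]|[c c1 /(lipschitz_unit_fractionsE c hf) lip]].
  (* The 64 is 8 * 8, from k ln p_k <= 8 p_k and (k + 1) ln p_k <= 8 p_{k+1}; the summand 1 secures
     c >= 1. *)
  exists (1 + 64 * C); first by lra.
  apply/(lipschitz_unit_fractionsE _ hf)/lipschitz_nth_prime_consecutive; first lra.
  move=> k k0; have := cramer k k0.
  have := mul_ln_le_nth_prime R k k0; have := mul_ln_le_nth_prime R k.+1 isT.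
  have lnpq : ln (nth_prime k)%:R <= ln (nth_prime k.+1)%:R :> R.
    apply: ln_nat_homo.
    by rewrite prime_gt0 ?nth_prime_prime // ltnW // nth_prime_ltS.
  have := ln_nth_prime_ge_half R k k0.
  have p0 := ler0n R (nth_prime k); have q0 := ler0n R (nth_prime k.+1).
  move: lnpq p0 q0; set p := (nth_prime k)%:R; set q := (nth_prime k.+1)%:R.
  move=> lnpq p0 q0 lnp0 le_q le_p le_gap.
  have klnp0 : 0 <= k%:R * ln p by rewrite mulr_ge0 //; lra.
  have : k.+1%:R * ln p <= 8 * q by apply: le_trans le_q; rewrite ler_wpM2l.
  move=> le_q'.
  have k1lnp0 : 0 <= k.+1%:R * ln p by rewrite mulr_ge0 //; lra.
  have := ler_pM klnp0 k1lnp0 le_p le_q'.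
  move/(ler_wpM2l (ltW C0)) => le_pq.
  have kk0 : 0 <= k%:R * k.+1%:R :> R by rewrite mulr_ge0.
  have := ler_wpM2l kk0 le_gap; have := mulr_ge0 p0 q0; lra.
have /lipschitz_nth_prime_consecutive gap : 0 <= c by lra.
move/gap: lip => {}gap.
(* The 360 is 6 * 60: p_k <= 6k ln p_k, and p_{k+1} <= 6(k + 1) ln p_{k+1} <= 60(k + 1) ln p_k. *)
exists (360 * c); first by lra.
move=> k k0; have := gap k k0.
have := nth_prime_le_mul_ln R k k0; have := nth_prime_le_mul_ln R k.+1 isT.
have := ln_nth_primeS_le R k k0; have := ln_nth_prime_ge_half R k k0.
have p0 := ler0n R (nth_prime k); have q0 := ler0n R (nth_prime k.+1).
move: p0 q0; set p := (nth_prime k)%:R; set q := (nth_prime k.+1)%:R.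
move=> p0 q0 lnp0 lnq le_q le_p le_gap.
have kk0 : 0 < k%:R * k.+1%:R :> R by rewrite mulr_gt0 ?ltr0n.
(* After multiplication by k(k + 1), it remains to bound c p_k p_{k+1} by 360 c k(k + 1) (ln
   p_k)^2. *)
rewrite -(ler_pM2l kk0); apply: le_trans le_gap _.
have le_q' : q <= 60 * k.+1%:R * ln p.
  apply: le_trans le_q _.
  have := ler_wpM2l (ler0n R k.+1) lnq; lra.
have := ler_pM p0 q0 le_p le_q'.
have c0 : 0 <= c by lra.
move/(ler_wpM2l c0); lra.
Qed.
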